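(* Let $(\theta_n)_{n\ge1}$ be a nondecreasing sequence of positive real numbers and write $\theta=\theta_n$. As $n\to\infty$, $$\| G_{n,\theta} - \Phi \|_\infty = \begin{cases} O\left(1/\sqrt{\theta\log(n/\theta)}\right) & \text{in Case A},\\ O\left(1/\sqrt{\theta}\right) & \text{in Case B},\\ O\left(1/\sqrt{n^2/\theta}\right) & \text{in Case C1}.\end{cases}$$
   Context: For $\theta>0$ and a positive integer $n$, let $K=K_{n,\theta}$ be a random variable with ${\rm P}(K=x)=\bar{s}(n,x)\theta^x/(\theta)_n$ for $x=1,\ldots,n$, where $(\theta)_n=\theta(\theta+1)\cdots(\theta+n-1)$ and $\bar{s}(n,x)$ is the coefficient of $\theta^x$ in $(\theta)_n$ viewed as a polynomial in $\theta$. Let $\mu_T=\theta\log\left(1+\frac{n}{\theta}\right)$ and $\sigma_T^2=\theta\left(\log\left(1+\frac{n}{\theta}\right)+\frac{\theta}{n+\theta}-1\right)$ with $\sigma_T>0$. $G_{n,\theta}$ is the distribution function of $Y_{n,\theta}=(K-\mu_T)/\sigma_T$, $\Phi$ is the standard normal distribution function, and $\|f\|_\infty=\sup_{x\in\mathbb{R}}|f(x)|$. The parameter $\theta=\theta_n$ may depend on $n$ and is nondecreasing in $n$ (constant $\theta$ allowed). Asymptotic regimes as $n\to\infty$: Case A: $n/\theta\to\infty$. Case B: $n/\theta\to c$ for some $0<c<\infty$. Case C1: $n/\theta\to0$ and $n^2/\theta\to\infty$. *)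

(* Defs.v *)
From HB Require Import structures.
From mathcomp Require Import all_boot all_order all_algebra.
From mathcomp Require Import all_classical all_reals all_analysis.
From mathcomp Require Import measurable_realfun.

Set Implicit Arguments.
Unset Strict Implicit.
Unset Printing Implicit Defensive.
Import Order.TTheory GRing.Theory Num.Theory.
Import numFieldNormedType.Exports.
Local Open Scope classical_set_scope.
Local Open Scope ring_scope.

(* Generic in the ring, so that it serves both for the number (theta)_n and
   for the polynomial ('X)_n whose coefficients are the unsigned Stirling
   numbers of the first kind. *)
Definition rising_factorial (A : nzSemiRingType) (a : A) (n : nat) : A :=
  \prod_(i < n) (a + i%:R).

Definition sbar (R : realType) (n x : nat) : R :=
  (rising_factorial ('X : {poly R}) n)`_x.

(* K is real-valued; the masses below sum to 1 over x = 1, ..., n, so no other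
   value has positive probability. *)
Definition has_law_K (R : realType) (n : nat) (theta : R)
    (d : measure_display) (T : measurableType d) (P : probability T R)
    (K : {RV P >-> R}) : Prop :=
  forall x : nat, (1 <= x <= n)%N ->
    P [set w | K w = x%:R]
      = (sbar R n x * theta ^+ x / rising_factorial theta n)%:E.

Definition mu_T (R : realType) (n : nat) (theta : R) : R :=
  theta * ln (1 + n%:R / theta).

Definition sigma2_T (R : realType) (n : nat) (theta : R) : R :=
  theta * (ln (1 + n%:R / theta) + theta / (n%:R + theta) - 1).

Definition sigma_T (R : realType) (n : nat) (theta : R) : R :=
  Num.sqrt (sigma2_T n theta).

Definition Y_T (R : realType) (n : nat) (theta : R) (T : Type) (K : T -> R)
    (w : T) : R :=
  (K w - mu_T n theta) / sigma_T n theta.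

Section Y_T_measurable.
Context (R : realType) (n : nat) (theta : R).
Context (d : measure_display) (T : measurableType d) (K : {mfun T >-> R}).

Lemma measurable_Y_T : measurable_fun [set: T] (Y_T n theta K).
Proof. apply: measurable_funM => //; exact: measurable_funB. Qed.

HB.instance Definition _ :=
  isMeasurableFun.Build _ _ T R (Y_T n theta K) measurable_Y_T.

End Y_T_measurable.

Definition G_T (R : realType) (n : nat) (theta : R)
    (d : measure_display) (T : measurableType d) (P : probability T R)
    (K : {RV P >-> R}) (x : R) : R :=
  fine (cdf (Y_T n theta K : {RV P >-> R}) x).

Definition Phi (R : realType) (x : R) : R :=
  fine (normal_prob (0 : R) 1 `]-oo, x]).

(* [sup] is meaningful for bounded f only; this holds for a difference of
   distribution functions. *)
Definition sup_norm (R : realType) (f : R -> R) : R :=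
  sup (range (fun x => `|f x|)).

Definition case_A (R : realType) (theta : nat -> R) : Prop :=
  n%:R / theta n @[n --> \oo] --> +oo.

Definition case_B (R : realType) (theta : nat -> R) : Prop :=
  exists2 c : R, 0 < c & n%:R / theta n @[n --> \oo] --> c.

Definition case_C1 (R : realType) (theta : nat -> R) : Prop :=
  n%:R / theta n @[n --> \oo] --> (0 : R) /\
  n%:R ^+ 2 / theta n @[n --> \oo] --> +oo.

(* Main.v *)
(* K is distributed as a sum of n independent Bernoulli variables xi_i with
   parameters theta / (theta + i), i < n. For such sums Stein's identity reads
   E (K - E K) g(K) = \sum_i p_i (1 - p_i) E (g(K - xi_i + 1) - g(K - xi_i)).
   Taking for g the solution of Stein's normal equation at a threshold on the
   lattice of values of (K - mu_T) / sigma_T, g is smooth between consecutive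
   lattice points and the identity gives a uniform normal approximation with
   error O(1 / sigma_T); the shift by xi_i costs only a point probability,
   itself O(1 / sigma_T) by the same identity applied to an indicator. The
   parameters mu_T and sigma_T^2 are the integrals approximating E K and Var K
   and differ from them by at most 1, so centering and scaling with them is
   harmless. It remains to bound sigma_T^2 from below in each regime. *)
Require Import Defs.
From HB Require Import structures.
From mathcomp Require Import all_boot all_order all_algebra.
From mathcomp Require Import all_classical all_reals all_analysis.
From mathcomp Require Import ring lra.
Import Order.TTheory GRing.Theory Num.Theory.
Import numFieldNormedType.Exports.
Local Open Scope classical_set_scope.
Local Open Scope ring_scope.

(** * Sums of independent Bernoulli variables and a discrete form of Stein's method *)

Section PoissonBinomial.
Context {R : realFieldType} (p : nat -> R).
Implicit Types (g h f : nat -> R) (n m : nat).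

(* [E g(K)], where K is the sum of the independent Bernoulli variables xi_i with
   parameters p_i, i < n. *)
Fixpoint pbE n g : R :=
  if n is n'.+1 then p n' * pbE n' (fun k => g k.+1) + (1 - p n') * pbE n' g
  else g 0%N.

(* [\sum_(i < n) p_i (1 - p_i) E h(K - xi_i)]. *)
Fixpoint pbD n h : R :=
  if n is n'.+1 then
    p n' * pbD n' (fun k => h k.+1) + (1 - p n') * pbD n' h
    + p n' * (1 - p n') * pbE n' h
  else 0.

Definition pb_mean n : R := \sum_(i < n) p i.
Definition pb_var n : R := \sum_(i < n) p i * (1 - p i).

Lemma pb_meanS n : pb_mean n.+1 = pb_mean n + p n.
Proof. by rewrite /pb_mean big_ord_recr. Qed.

Lemma pb_varS n : pb_var n.+1 = pb_var n + p n * (1 - p n).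
Proof. by rewrite /pb_var big_ord_recr. Qed.

Lemma eq_pbE n g h : g =1 h -> pbE n g = pbE n h.
Proof.
elim: n g h => [|n IH] g h gh /=; first exact: gh.
by rewrite (IH _ _ (fun k => gh k.+1)) (IH _ _ gh).
Qed.

Lemma eq_pbD n g h : g =1 h -> pbD n g = pbD n h.
Proof.
elim: n g h => [//|n IH] g h gh /=.
by rewrite (IH _ _ (fun k => gh k.+1)) (IH _ _ gh) (eq_pbE n _ _ gh).
Qed.

Lemma pbE_linear n a b g h :
  pbE n (fun k => a * g k + b * h k) = a * pbE n g + b * pbE n h.
Proof. by elim: n g h => [//|n IH] g h /=; rewrite !IH; ring. Qed.

Lemma pbD_linear n a b g h :
  pbD n (fun k => a * g k + b * h k) = a * pbD n g + b * pbD n h.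
Proof.
by elim: n g h => [|n IH] g h /=; rewrite ?pbE_linear ?IH; ring.
Qed.

Lemma pbE_comb n a b g h f : (forall k, f k = a * g k + b * h k) ->
  pbE n f = a * pbE n g + b * pbE n h.
Proof. by move=> fE; rewrite -pbE_linear; exact: eq_pbE. Qed.

Lemma pbD_comb n a b g h f : (forall k, f k = a * g k + b * h k) ->
  pbD n f = a * pbD n g + b * pbD n h.
Proof. by move=> fE; rewrite -pbD_linear; exact: eq_pbD. Qed.

Lemma pbE_cst n a : pbE n (fun=> a) = a.
Proof. by elim: n => [//|n IH] /=; rewrite IH; ring. Qed.

Lemma pbD_cst n a : pbD n (fun=> a) = a * pb_var n.
Proof.
elim: n => [|n IH] /=; first by rewrite /pb_var big_ord0 mulr0.
by rewrite pb_varS IH pbE_cst; ring.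
Qed.

(** By induction: conditioning on the newest variable creates the last term of [pbD], and the
    induction hypothesis applies to [g] and to its shift. *)
Lemma stein_identity n g :
  pbE n (fun k => (k%:R - pb_mean n) * g k) = pbD n (fun k => g k.+1 - g k).
Proof.
elim: n g => [|n IH] g /=; first by rewrite /pb_mean big_ord0 subrr mul0r.
rewrite -!IH pb_meanS.
rewrite (pbE_comb n 1 (1 - p n) (fun k => (k%:R - pb_mean n) * g k.+1)
  (fun k => g k.+1)); last by move=> k; rewrite -natr1; ring.
rewrite (pbE_comb n 1 (- p n) (fun k => (k%:R - pb_mean n) * g k) g
  (fun k => (k%:R - (pb_mean n + p n)) * g k)); last by move=> k; ring.
rewrite (pbE_comb n 1 (-1) (fun k => g k.+1) g (fun k => g k.+1 - g k));
  last by move=> k; ring.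
by ring.
Qed.

Hypothesis p01 : forall i, 0 <= p i <= 1.

Let p_ge0 i : 0 <= p i. Proof. by case/andP: (p01 i). Qed.
Let q_ge0 i : 0 <= 1 - p i. Proof. by rewrite subr_ge0; case/andP: (p01 i). Qed.

Lemma ler_pbE n g h : (forall k, g k <= h k) -> pbE n g <= pbE n h.
Proof.
elim: n g h => [|n IH] g h gh /=; first exact: gh.
by apply: lerD; apply: ler_wpM2l; rewrite // IH.
Qed.

Lemma ler_pbD n g h : (forall k, g k <= h k) -> pbD n g <= pbD n h.
Proof.
elim: n g h => [//|n IH] g h gh /=.
apply: lerD; last by rewrite ler_wpM2l ?mulr_ge0 // ler_pbE.
by apply: lerD; apply: ler_wpM2l; rewrite // IH.
Qed.

Lemma pbE_le_cst n g a : (forall k, `|g k| <= a) -> `|pbE n g| <= a.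
Proof.
move=> ga; rewrite ler_norml -{1}(pbE_cst n (- a)) -{2}(pbE_cst n a).
apply/andP; split; apply: ler_pbE => k.
  by have := ga k; rewrite ler_norml => /andP[].
by have := ga k; rewrite ler_norml => /andP[].
Qed.

Lemma pbD_le n g h r : (forall k, `|g k - h k| <= r k) ->
  `|pbD n g - pbD n h| <= pbD n r.
Proof.
move=> gh; rewrite ler_norml.
have E1 a b f g' : a * pbD n f + b * pbD n g' =
  pbD n (fun k => a * f k + b * g' k) by rewrite pbD_linear.
have := @ler_pbD n g (fun k => 1 * h k + 1 * r k).
have := @ler_pbD n (fun k => 1 * h k + (-1) * r k) g.
rewrite !pbD_linear => H1 H2.
have {}H1 : 1 * pbD n h + -1 * pbD n r <= pbD n g.
  by apply: H1 => k; have := gh k; rewrite ler_norml => /andP[]; lra.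
have {}H2 : pbD n g <= 1 * pbD n h + 1 * pbD n r.
  by apply: H2 => k; have := gh k; rewrite ler_norml => /andP[]; lra.
by apply/andP; split; lra.
Qed.

(* Whatever the value of xi_i, [f K] is bounded by [h (K - xi_i)]. *)
Lemma pb_var_pbE_le_pbD n f h :
  (forall k, f k <= h k) -> (forall k, f k.+1 <= h k) ->
  pb_var n * pbE n f <= pbD n h.
Proof.
elim: n f h => [|n IH] f h fh fh1 /=; first by rewrite /pb_var big_ord0 mul0r.
rewrite pb_varS.
have H1 := IH (fun k => f k.+1) (fun k => h k.+1) (fun k => fh _) (fun k => fh1 _).
have {}H2 := IH f h fh fh1.
have H3 : p n * pbE n (fun k => f k.+1) + (1 - p n) * pbE n f <= pbE n h.
  have := ler_wpM2l (p_ge0 n) (ler_pbE n _ _ fh1).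
  have := ler_wpM2l (q_ge0 n) (ler_pbE n _ _ fh).
  lra.
have {}H1 := ler_wpM2l (p_ge0 n) H1.
have {}H2 := ler_wpM2l (q_ge0 n) H2.
have {}H3 := ler_wpM2l (mulr_ge0 (p_ge0 n) (q_ge0 n)) H3.
apply: le_trans (lerD (lerD H1 H2) H3); rewrite le_eqVlt; apply/orP; left.
by apply/eqP; ring.
Qed.

Lemma pbD_le_pb_var_pbE n f h :
  (forall k, h k <= f k) -> (forall k, h k <= f k.+1) ->
  pbD n h <= pb_var n * pbE n f.
Proof.
move=> fh fh1.
(* The mirrored inequality follows by negating both functions; the terms with coefficient 0 only
   bring the negation into the shape of [pbE_linear]. *)
have := @pb_var_pbE_le_pbD n (fun k => (-1) * f k + 0 * f k)
   (fun k => (-1) * h k + 0 * h k).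
rewrite pbE_linear pbD_linear => H.
have : pb_var n * (-1 * pbE n f + 0 * pbE n f) <= -1 * pbD n h + 0 * pbD n h.
  apply: H => k; first by have := fh k; lra.
  by have := fh1 k; lra.
rewrite !mul0r !addr0 !mulN1r mulrN lerNr opprK //.
Qed.

Lemma pb_variance n :
  pbE n (fun k => (k%:R - pb_mean n) ^+ 2) = pb_var n.
Proof.
rewrite (eq_pbE n _ (fun k => (k%:R - pb_mean n) * (k%:R - pb_mean n))) //.
rewrite stein_identity (eq_pbD n _ (fun=> 1)) ?pbD_cst ?mul1r // => k.
by rewrite -natr1; ring.
Qed.

(** Pointwise arithmetic-geometric mean inequality; the free parameter [s] stands in for the
    standard deviation, since a [realFieldType] need not have square roots. *)
Lemma pb_abs_deviation n s : 0 < s ->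
  pbE n (fun k => `|k%:R - pb_mean n|) <= (pb_var n / s + s) / 2.
Proof.
move=> s0.
have -> : (pb_var n / s + s) / 2 =
  pbE n (fun k => (s^-1 / 2) * (k%:R - pb_mean n) ^+ 2 + (s / 2) * 1).
  by rewrite pbE_linear pb_variance pbE_cst; ring.
apply: ler_pbE => k; rewrite -real_normK ?num_real //.
set y := `|_|; rewrite -subr_ge0.
have -> : s^-1 / 2 * y ^+ 2 + s / 2 * 1 - y = s^-1 / 2 * (y - s) ^+ 2.
  by field; rewrite gt_eqF.
by rewrite mulr_ge0 ?sqr_ge0 // divr_ge0 // invr_ge0 ltW.
Qed.

(** Stein's identity for the indicator of [m <= k], whose only nonzero increment is at
    [k.+1 = m]. *)
Lemma pbD_atom n m :
  pbD n (fun k => (k.+1 == m)%:R) <= pbE n (fun k => `|k%:R - pb_mean n|).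
Proof.
have -> : pbD n (fun k => (k.+1 == m)%:R) =
    pbE n (fun k => (k%:R - pb_mean n) * (m <= k)%:R).
  rewrite stein_identity; apply: eq_pbD => k.
  rewrite (leq_eqVlt m k.+1) ltnS eq_sym; case: eqP => [->|_] /=.
    by rewrite ltnn subr0.
  by rewrite subrr.
apply: ler_pbE => k; apply: le_trans (ler_norm _) _.
by rewrite normrM; case: leq; rewrite ?normr1 ?normr0 ?mulr1 ?mulr0.
Qed.

(** [F] stands for [Phi] at the threshold and [g] for the Stein solution on the lattice; the last
    hypothesis is Stein's equation with a difference quotient for the derivative. Applying [pbD] to
    it, the left side is nearly [s ^+ 2 * W] and the right side nearly [V * W + V * (I - F)]. The
    terms in [W] cancel because [V] is within 1 of [s ^+ 2]. *)
Lemma discrete_stein_bound n m g (c s B F : R) (w := fun k : nat => (k%:R - c) / s) :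
  0 < s -> 2 <= s ^+ 2 -> `|pb_mean n - c| <= 1 -> `|pb_var n - s ^+ 2| <= 1 ->
  (forall k, `|g k| <= B) -> (forall k, `|w k * g k| <= 1) ->
  (forall k, `|w k.+1 * g k.+1 - w k * g k| <= (B + 4 + 2 * `|w k|) / s) ->
  (forall k, `|s * (g k.+1 - g k) - (w k * g k + ((k < m)%:R - F))|
     <= (B + 4 + 2 * `|w k|) / s) ->
  `|pbE n (fun k => (k < m)%:R) - F| <= (4 * B + 30) / s.
Proof.
move=> s0 s2 mc vs gB wg H3 H4.
have B0 : 0 <= B by apply: le_trans (gB 0%N).
have s1 : 1 <= s by rewrite -(ler_pXn2r (isT : (0 < 2)%N)) ?nnegrE ?ltW // expr1n; lra.
have si : 0 < s^-1 by rewrite invr_gt0.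
have si1 : s^-1 <= 1 by rewrite invf_le1.
pose r k := (B + 4 + 2 * `|w k|).
pose V := pb_var n.
have [V1 V2] : s ^+ 2 - 1 <= V /\ V <= s ^+ 2 + 1.
  by move: vs; rewrite ler_norml -/V => /andP[]; split; lra.
have V0 : 0 < V by lra.
pose I := pbE n (fun k => (k < m)%:R).
pose W := pbE n (fun k => w k * g k).
pose G := pbE n g.
pose Dr := pbD n r.
pose A := pbE n (fun k => `|k%:R - pb_mean n|).
(* From [2 <= s ^+ 2], [V <= s ^+ 2 + 1 <= 3 / 2 * s ^+ 2]. *)
have A_le : A <= 5 / 4 * s.
  apply: le_trans (pb_abs_deviation n s s0) _.
  suff : V / s <= 3 / 2 * s by rewrite -/V; lra.
  by rewrite ler_pdivrMr //; lra.
have Dr_le : Dr <= V * (B + 11).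
  (* Both [f k] and [f k.+1] must dominate [r k]: passing from [w k.+1] to [w k] costs [s^-1 <= 1],
     and replacing [c] by the mean costs another [s^-1]. *)
  pose f k := (B + 6 + 2 / s) * 1 + 2 / s * `|k%:R - pb_mean n|.
  have Hw k : `|w k| <= (1 + `|k%:R - pb_mean n|) / s.
    rewrite /w normrM (gtr0_norm si) ler_pM2r //.
    have -> : k%:R - c = (k%:R - pb_mean n) + (pb_mean n - c) by ring.
    by apply: le_trans (ler_normD _ _) _; lra.
  have Hw1 k : `|w k| <= 1 + `|w k.+1|.
    have -> : w k = - s^-1 + w k.+1 by rewrite /w -natr1; field; rewrite gt_eqF.
    apply: le_trans (ler_normD _ _) _; rewrite normrN (gtr0_norm si); lra.
  have : Dr <= V * pbE n f.
    apply: pbD_le_pb_var_pbE => k; rewrite /r /f.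
      have := Hw k; lra.
    have := Hw1 k; have := Hw k.+1; lra.
  move=> /le_trans; apply; rewrite ler_pM2l // /f pbE_linear pbE_cst -/A.
  have : 2 / s * A <= 5 / 2.
    have := ler_wpM2l (ltW si) A_le.
    have -> : s^-1 * (5 / 4 * s) = 5 / 4 by field; rewrite gt_eqF.
    lra.
  lra.
(* Stein's identity, with [k%:R - pb_mean n] split as [s * w k + (c - pb_mean n)]. *)
have K0 : pbD n (fun k => s * (g k.+1 - g k)) = s ^+ 2 * W + s * (c - pb_mean n) * G.
  transitivity (s * pbD n (fun k => g k.+1 - g k)).
    rewrite (pbD_comb n s 0 (fun k => g k.+1 - g k) g) ?mul0r ?addr0 // => k.
    by ring.
  rewrite -stein_identity /W /G.
  rewrite (pbE_comb n s (c - pb_mean n) (fun k => w k * g k) g).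
    by ring.
  by move=> k; rewrite /w; field; rewrite gt_eqF.
have K1 : `|pbD n (fun k => s * (g k.+1 - g k)) -
   (pbD n (fun k => w k * g k) + (pbD n (fun k => (k < m)%:R) - F * V))| <= Dr / s.
  have E : Dr / s = pbD n (fun k => r k / s).
    rewrite (pbD_comb n s^-1 0 r g) ?mul0r ?addr0 1?mulrC // => k.
    by ring.
  rewrite E.
  have -> : (pbD n (fun k => w k * g k) + (pbD n (fun k => (k < m)%:R) - F * V))
    = pbD n (fun k => w k * g k + ((k < m)%:R - F)).
    rewrite -pbD_cst.
    rewrite (pbD_comb n 1 1 (fun k => w k * g k) (fun k => (k < m)%:R - F)
      (fun k => w k * g k + ((k < m)%:R - F)));
      last by move=> k; ring.
    rewrite (pbD_comb n 1 (-1) (fun k => (k < m)%:R) (fun=> F)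
      (fun k => (k < m)%:R - F)); last by move=> k; ring.
    by ring.
  exact: pbD_le.
(* Restoring the omitted variable moves the argument by at most one lattice step, which changes
   [w k * g k] by at most [r k / s]. *)
have K2 : `|pbD n (fun k => w k * g k) - V * W| <= Dr / s.
  have E b : pbD n (fun k => 1 * (w k * g k) + b * r k) = pbD n (fun k => w k * g k) + b * Dr.
    by rewrite pbD_linear mul1r.
  have H k : 0 <= s^-1 * r k.
    by rewrite mulr_ge0 ?(ltW si) // /r; have := normr_ge0 (w k); lra.
  have L : V * W <= pbD n (fun k => w k * g k) + s^-1 * Dr.
    rewrite -E; apply: pb_var_pbE_le_pbD => k.
      have := H k; lra.
    by have := H3 k; rewrite ler_norml -/(r k) => /andP[]; lra.
  have U : pbD n (fun k => w k * g k) + (- s^-1) * Dr <= V * W.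
    rewrite -E; apply: pbD_le_pb_var_pbE => k.
      have := H k; lra.
    by have := H3 k; rewrite ler_norml -/(r k) => /andP[]; lra.
  by rewrite ler_norml; apply/andP; split; lra.
(* The indicator changes under a unit shift only where [k.+1 = m], so the cost is the point mass
   bounded by [pbD_atom]. *)
have K3 : `|pbD n (fun k => (k < m)%:R) - V * I| <= 5 / 4 * s.
  have L : V * I <= pbD n (fun k => (k < m)%:R).
    apply: pb_var_pbE_le_pbD => k //.
    by rewrite ler_nat; case: (ltnP k.+1 m) => // /ltnW ->.
  have U : 1 * pbD n (fun k => (k < m)%:R) + (-1) * pbD n (fun k => (k.+1 == m)%:R) <= V * I.
    rewrite -pbD_linear; apply: pbD_le_pb_var_pbE => k.
      have : 0 <= (k.+1 == m)%:R :> R by []. lra.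
    by case: (ltngtP k.+1 m) => /=; lra.
  have := pbD_atom n m; rewrite -/A => HA.
  by rewrite ler_norml; apply/andP; split; lra.
have W1 : `|(V - s ^+ 2) * W| <= 1.
  by rewrite normrM mulr_ile1 //; exact: pbE_le_cst.
have G1 : `|s * (c - pb_mean n) * G| <= s * B.
  rewrite normrM normrM (gtr0_norm s0) -mulrA ler_pM2l // -[leRHS]mul1r.
  by apply: ler_pM => //; [rewrite distrC | exact: pbE_le_cst].
have DD : Dr / s <= (V / s) * (B + 11).
  by rewrite mulrAC ler_pM2r.
have key : V * `|I - F| <= 1 + s * B + 2 * ((V / s) * (B + 11)) + 5 / 4 * s.
  rewrite -{1}(gtr0_norm V0) -normrM.
  move: K1 K2 K3 W1 G1; rewrite K0 !ler_norml.
  move=> /andP[? ?] /andP[? ?] /andP[? ?] /andP[? ?] /andP[? ?].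
  by apply/andP; split; lra.
rewrite ler_pdivlMr //.
(* Uses [s ^+ 2 - 1 <= V] and [2 <= s ^+ 2]; multiplying [key] by [s / V] then leaves only bounded
   terms. *)
have sV : s ^+ 2 <= 2 * V by lra.
have sVi : s / V * s <= 2.
  by rewrite mulrAC ler_pdivrMr // -expr2.
have sVp : 0 <= s / V by rewrite divr_ge0 // ltW.
have := ler_wpM2l sVp key.
have -> : s / V * (V * `|I - F|) = `|I - F| * s by field; rewrite gt_eqF.
move=> /le_trans; apply.
have -> : s / V * (1 + s * B + 2 * (V / s * (B + 11)) + 5 / 4 * s) =
  s / V * 1 + (s / V * s) * B + 2 * (B + 11) + 5 / 4 * (s / V * s).
  by field; rewrite !gt_eqF.
have : s / V * s * B <= 2 * B by rewrite ler_wpM2r.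
have : s / V * 1 <= s / V * s by rewrite ler_wpM2l.
lra.
Qed.

End PoissonBinomial.

(** * The normal distribution function, its density and Mills' ratio *)

Section NormalCDF.
Context {R : realType}.
Implicit Types (x w z : R).

Definition gauss_pdf x : R := normal_pdf 0 1 x.

Lemma gauss_pdfE x : gauss_pdf x = normal_peak 1 * expR (- x ^+ 2 / 2).
Proof.
by rewrite /gauss_pdf normal_pdfE ?oner_eq0 // /normal_fun subr0 expr1n.
Qed.

Lemma gauss_pdf_gt0 x : 0 < gauss_pdf x.
Proof. by rewrite gauss_pdfE mulr_gt0 ?expR_gt0 // normal_peak_gt0 ?oner_eq0. Qed.

Lemma gauss_pdfN x : gauss_pdf (- x) = gauss_pdf x.
Proof. by rewrite !gauss_pdfE sqrrN. Qed.

Lemma gauss_pdf_le x : gauss_pdf x <= normal_peak 1.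
Proof. by rewrite /gauss_pdf normal_pdf_ub ?oner_eq0. Qed.

Lemma gauss_pdf_decr x z : 0 <= x -> x <= z -> gauss_pdf z <= gauss_pdf x.
Proof.
move=> x0 xz; rewrite !gauss_pdfE ler_pM2l ?normal_peak_gt0 ?oner_eq0 //.
rewrite ler_expR ler_pM2r // lerN2 lerXn2r // nnegrE //.
exact: le_trans xz.
Qed.

Lemma is_derive_gauss_pdf x : is_derive x 1 gauss_pdf (- x * gauss_pdf x).
Proof.
rewrite (funext gauss_pdfE).
apply: is_derive_eq.
by rewrite /GRing.scale /=; field.
Qed.

Lemma Phi_fine x : (Phi x)%:E = normal_prob (0 : R) 1 `]-oo, x].
Proof. by rewrite /Phi fineK // fin_num_measure. Qed.

(** The identity as a random variable under the normal law: its distribution function is [Phi],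
    which gives the limits of [Phi] at both infinities. *)
Let idTR : measurableTypeR R -> R := idfun.

#[local] HB.instance Definition _ :=
  @isMeasurableFun.Build _ _ _ _ idTR (@measurable_id _ _ setT).

Let Phi_cdf x : (Phi x)%:E = cdf (idTR : {RV (normal_prob (0:R) 1) >-> R}) x.
Proof. by rewrite Phi_fine. Qed.

Lemma Phi_ge0 x : 0 <= Phi x.
Proof. by rewrite -lee_fin Phi_fine measure_ge0. Qed.

Lemma Phi_le1 x : Phi x <= 1.
Proof. by rewrite -lee_fin Phi_fine probability_le1. Qed.

Lemma Phi_le x z : x <= z -> Phi x <= Phi z.
Proof.
move=> xz; rewrite -lee_fin !Phi_fine le_measure ?inE // => t /=.
by rewrite !in_itv /= => /le_trans; apply.
Qed.

Lemma is_derive_Phi x : is_derive x 1 (@Phi R) (gauss_pdf x).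
Proof.
(* The endpoint [x + 1] is arbitrary beyond [x]. *)
have [] := @continuous_FTC1 R (@normal_pdf R 0 1) -oo%O x (x + 1).
- by rewrite ltrDl.
- apply: (@integrableS _ _ _ _ setT) => //.
  exact: integrable_normal_pdf.
- by rewrite ltNyr.
- by apply: continuous_normal_pdf; rewrite oner_eq0.
move=> d1 d2; apply: DeriveDef; first exact: d1.
by rewrite -derive1E d2.
Qed.

Lemma Phi_cvgy : @Phi R x @[x --> +oo] --> (1 : R).
Proof.
have := cvg_cdfy1 (idTR : {RV (normal_prob (0:R) 1) >-> R}).
rewrite -(funext Phi_cdf) => /fine_cvgP [_]; exact.
Qed.

Lemma Phi_cvgNy : @Phi R x @[x --> -oo] --> (0 : R).
Proof.
have := cvg_cdfNy0 (idTR : {RV (normal_prob (0:R) 1) >-> R}).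
rewrite -(funext Phi_cdf) => /fine_cvgP [_]; exact.
Qed.

(** The function [M] below is nonincreasing on the positive axis and is bounded below by [F x - 1],
    which tends to 0; hence [0 <= M w]. [F] is kept general to cover both [Phi] and its reflection
    [1 - Phi (- x)], which serves the left tail. *)
Lemma mills (F : R -> R) :
  (forall x, is_derive x 1 F (gauss_pdf x)) -> F x @[x --> +oo] --> (1 : R) ->
  forall w, 0 < w -> 1 - F w <= gauss_pdf w / w.
Proof.
move=> dF F1 w w0.
pose M x := gauss_pdf x / x - (1 - F x).
have dM x : 0 < x -> is_derive x 1 M (- gauss_pdf x / x ^+ 2).
  move=> x0; have xN0 : x != 0 by rewrite gt_eqF.
  have dp := is_derive_gauss_pdf x; have dFx := dF x.
  have dV : is_derive x 1 (fun y : R => y^-1) (- x ^- 2 *: 1) by exact: is_deriveV.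
  apply: is_derive_eq.
  by rewrite /GRing.scale /=; field.
have M_le x : w <= x -> M x <= M w.
  rewrite le_eqVlt => /predU1P[->//|wx].
  have dM' y : y \in `]w, x[ -> is_derive y 1 M (- gauss_pdf y / y ^+ 2).
    by rewrite in_itv /= => /andP[wy _]; apply: dM; exact: lt_trans wy.
  have cM : {within `[w, x], continuous M}.
    apply: derivable_within_continuous => y.
    rewrite in_itv /= => /andP[wy _].
    by have [] := dM y (lt_le_trans w0 wy).
  have [y _ E] := MVT wx dM' cM.
  rewrite -subr_le0 E; apply: mulr_le0_ge0; last by rewrite subr_ge0 ltW.
  apply: mulr_le0_ge0; last by rewrite invr_ge0 sqr_ge0.
  by rewrite oppr_le0 ltW ?gauss_pdf_gt0.
have Mw x : w <= x -> F x - 1 <= M w.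
  move=> wx; apply: le_trans (M_le _ wx); rewrite /M.
  have : 0 <= gauss_pdf x / x by rewrite divr_ge0 ?(le_trans (ltW w0) wx) // ltW // gauss_pdf_gt0.
  lra.
suff : 0 <= M w by rewrite /M; lra.
have L : F x - 1 @[x --> +oo] --> (1 - 1 : R) by apply: cvgB => //; exact: cvg_cst.
rewrite -(subrr 1) -(cvg_lim _ L) //.
apply: limr_le; first exact: cvgP L.
near=> x; apply: Mw; near: x; apply: nbhs_pinfty_ge; rewrite num_real.
Unshelve. all: by end_near.
Qed.

Lemma mills_r w : 0 < w -> 1 - Phi w <= gauss_pdf w / w.
Proof. exact: (mills (@Phi R) is_derive_Phi Phi_cvgy). Qed.

Lemma mills_l w : w < 0 -> Phi w <= gauss_pdf w / (- w).
Proof.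
move=> w0.
have := mills (fun x => 1 - Phi (- x)) _ _ (- w).
rewrite !opprK subKr gauss_pdfN oppr_gt0; apply => //.
- move=> x; have dP := is_derive_Phi (- x).
  have dN : is_derive x 1 (fun y : R => - y) (- 1) by exact: is_deriveNid.
  have dC : is_derive x 1 (fun y : R => Phi (- y)) (gauss_pdf (- x) * - 1).
    exact: (is_derive1_comp dP dN).
  apply: is_derive_eq; rewrite gauss_pdfN; ring.
- rewrite -[X in _ --> X]subr0; apply: cvgB; first exact: cvg_cst.
  have := Phi_cvgNy; rewrite cvgNy_compNP; exact.
Qed.

Definition mills_bound : R := 1 + (gauss_pdf 1)^-1.

Lemma mills_bound_ge0 : 0 <= mills_bound.
Proof. by rewrite addr_ge0 // invr_ge0 ltW // gauss_pdf_gt0. Qed.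

(** [u] is a tail probability. Up to [w = 1] the density is at least [gauss_pdf 1]; beyond it the
    Mills inequality bounds the ratio by 1. The two bounds are added in [mills_bound]. *)
Lemma mills_ratio w u : 0 <= w -> 0 <= u <= 1 ->
   (0 < w -> u <= gauss_pdf w / w) ->
  u / gauss_pdf w <= mills_bound /\ w * (u / gauss_pdf w) <= 1.
Proof.
move=> w0 /andP[u0 u1] H.
have pw := gauss_pdf_gt0 w; have p1 := gauss_pdf_gt0 1.
have W : w * (u / gauss_pdf w) <= 1.
  move: w0; rewrite le_eqVlt => /predU1P[<-|w0]; first by rewrite mul0r.
  by rewrite mulrA ler_pdivrMr // mul1r mulrC -ler_pdivlMr // H.
split => //; have [w1|w1] := leP w 1.
  rewrite /mills_bound ler_wpDl // -[leRHS]mul1r; apply: ler_pM => //.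
    by rewrite invr_ge0 ltW.
  by rewrite lef_pV2 // gauss_pdf_decr.
rewrite /mills_bound ler_wpDr //; first by rewrite invr_ge0 ltW.
apply: le_trans W; rewrite ler_peMl ?(ltW w1) //.
by rewrite divr_ge0 // ltW.
Qed.

Lemma Phi_lipschitz x y : x <= y -> Phi y - Phi x <= normal_peak 1 * (y - x).
Proof.
move=> xy; have cP : {within `[x, y], continuous (@Phi R)}.
  apply: derivable_within_continuous => t _.
  by have [] := is_derive_Phi t.
have [t _ ->] := MVT_segment xy (fun t _ => is_derive_Phi t) cP.
by rewrite ler_wpM2r ?subr_ge0 // gauss_pdf_le.
Qed.

End NormalCDF.

(** * The solution of Stein's normal equation and its bounds *)

Section SteinSolution.
Context {R : realType}.

(** The equation bounds the derivative of [f] by 2, so [f] is Lipschitz; hence [x * f x], and with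
    it the derivative, varies little on the interval. The mean value theorem then compares the
    increment of [f] with its linearization at [u]. *)
Lemma stein_increments (f : R -> R) (a b u v : R) :
  `|a| <= 1 -> u < v -> (forall x : R, is_derive x 1 f (a + x * f x)) ->
  (forall x, u <= x <= v -> `|f x| <= b) ->
  (forall x, u <= x <= v -> `|x * f x| <= 1) ->
  `|f v - f u - (v - u) * (a + u * f u)| <= (v - u) ^+ 2 * (b + 2 * `|u|) /\
  `|v * f v - u * f u| <= (v - u) * (b + 2 * `|u|).
Proof.
move=> a1 uv df fb xf1.
have cf y : {within `[u, y], continuous f}.
  apply: derivable_within_continuous => t _.
  by have [] := df t.
have lip y : u <= y <= v -> `|f y - f u| <= 2 * (v - u).
  move=> /andP[uy yv]; have [t tuy ->] := MVT_segment uy (fun t _ => df t) (cf y).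
  move: tuy; rewrite in_itv /= => /andP[ut ty].
  rewrite normrM; apply: ler_pM => //.
    apply: le_trans (ler_normD _ _) _.
    by have := xf1 t; rewrite ut (le_trans ty yv) => /(_ isT); lra.
  by rewrite ger0_norm ?subr_ge0 // lerD2r.
have wf y : u <= y <= v -> `|y * f y - u * f u| <= (v - u) * (b + 2 * `|u|).
  move=> uyv; have -> : y * f y - u * f u = (y - u) * f y + u * (f y - f u) by ring.
  apply: le_trans (ler_normD _ _) _; rewrite [leRHS]mulrDr; apply: lerD.
    rewrite normrM; apply: ler_pM => //; last exact: fb.
    by move: uyv => /andP[uy yv]; rewrite ger0_norm ?subr_ge0 // lerD2r.
  rewrite normrM mulrA (mulrC _ `|u|); apply: ler_wpM2l => //.
  by rewrite mulrC; exact: lip.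
split; last by apply: wf; rewrite lexx ltW.
have [t tuv ->] := MVT uv (fun t _ => df t) (cf v).
move: tuv; rewrite in_itv /= => /andP[ut tv].
have -> : (a + t * f t) * (v - u) - (v - u) * (a + u * f u) =
  (v - u) * (t * f t - u * f u) by ring.
rewrite normrM gtr0_norm ?subr_gt0 // expr2 -mulrA ler_pM2l ?subr_gt0 //.
by apply: wf; rewrite !ltW.
Qed.

Variable z : R.

(* The bounded solution of Stein's equation
   [f' w - w * f w = (w <= z)%:R - Phi z] is [stein_l] to the left of [z] and
   [stein_r] to its right. *)
Definition stein_l (w : R) : R := (1 - Phi z) * (Phi w / gauss_pdf w).
Definition stein_r (w : R) : R := Phi z * ((1 - Phi w) / gauss_pdf w).

Let Phi01 (x : R) : 0 <= Phi x <= 1.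
Proof. by rewrite Phi_ge0 Phi_le1. Qed.

Let PhiC01 (x : R) : 0 <= 1 - Phi x <= 1.
Proof. by have /andP[] := Phi01 x; lra. Qed.

Let is_derive_inv_pdf (w : R) :
  is_derive w 1 (fun y : R => (gauss_pdf y)^-1) (w / gauss_pdf w).
Proof.
have pw : gauss_pdf w != 0 by rewrite gt_eqF ?gauss_pdf_gt0.
have dp := is_derive_gauss_pdf w.
have dV := is_deriveV pw dp.
apply: is_derive_eq.
by rewrite /GRing.scale /=; field.
Qed.

Lemma is_derive_stein_l (w : R) : is_derive w 1 stein_l (1 - Phi z + w * stein_l w).
Proof.
have pw : gauss_pdf w != 0 by rewrite gt_eqF ?gauss_pdf_gt0.
have dP := is_derive_Phi w; have dI := is_derive_inv_pdf w.
rewrite /stein_l; apply: is_derive_eq.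
by rewrite /GRing.scale /=; field.
Qed.

Lemma is_derive_stein_r (w : R) : is_derive w 1 stein_r (- Phi z + w * stein_r w).
Proof.
have pw : gauss_pdf w != 0 by rewrite gt_eqF ?gauss_pdf_gt0.
have dP := is_derive_Phi w; have dI := is_derive_inv_pdf w.
rewrite /stein_r; apply: is_derive_eq.
by rewrite /GRing.scale /=; field.
Qed.

Let ratio_r (w : R) : 0 <= w ->
  (1 - Phi w) / gauss_pdf w <= mills_bound /\
  w * ((1 - Phi w) / gauss_pdf w) <= 1.
Proof. by move=> w0; apply: mills_ratio => // /mills_r. Qed.

Let ratio_l (w : R) : w <= 0 ->
  Phi w / gauss_pdf w <= mills_bound /\ - w * (Phi w / gauss_pdf w) <= 1.
Proof.
move=> w0; rewrite -(gauss_pdfN w); apply: mills_ratio => //.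
  by rewrite oppr_ge0.
by rewrite oppr_gt0 gauss_pdfN => /mills_l.
Qed.

Let damped_ratio_bound (w c y : R) : 0 <= c <= 1 -> 0 <= y -> y <= mills_bound -> `|w| * y <= 1 ->
  `|c * y| <= mills_bound /\ `|w * (c * y)| <= 1.
Proof.
move=> /andP[c0 c1] y0 yb wy.
have cy : c * y <= y by rewrite ler_piMl.
have cy0 : 0 <= c * y by rewrite mulr_ge0.
rewrite (normrM w) (ger0_norm cy0); split; first exact: le_trans cy yb.
by apply: le_trans wy; rewrite ler_wpM2l.
Qed.

(** For [w <= 0] this is the left Mills ratio damped by [1 - Phi z]. For [0 < w <= z] that factor is
    traded for [1 - Phi w], which is at least as large, to reach the right Mills ratio. *)
Lemma stein_l_bound w : w <= z ->
  `|stein_l w| <= mills_bound /\ `|w * stein_l w| <= 1.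
Proof.
move=> wz; have pw := gauss_pdf_gt0 w; rewrite /stein_l.
have [w0|w0] := leP w 0.
  have [H1 H2] := ratio_l w w0; apply: damped_ratio_bound => //.
    by rewrite divr_ge0 ?Phi_ge0 // ltW.
  by rewrite ler0_norm.
have [H1 H2] := ratio_r w (ltW w0).
set c := (1 - Phi z) / (1 - Phi w) * Phi w.
have PwC : 1 - Phi z <= 1 - Phi w by rewrite lerD2l lerN2 Phi_le.
have PzC0 : 0 <= 1 - Phi z by case/andP: (PhiC01 z).
have PwC0 : 0 <= 1 - Phi w by case/andP: (PhiC01 w).
(* A vanishing tail at [w] forces a vanishing tail at [z], and then [stein_l] is 0; otherwise the
   quotient in [c] is a genuine one. *)
have [Pw|Pw] := eqVneq (1 - Phi w) 0.
  have -> : 1 - Phi z = 0 by apply/eqP; rewrite eq_le PzC0 -Pw PwC.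
  by rewrite !(mul0r, mulr0) normr0 ler01 mills_bound_ge0.
have -> : (1 - Phi z) * (Phi w / gauss_pdf w) = c * ((1 - Phi w) / gauss_pdf w).
  by rewrite /c; field; rewrite Pw gt_eqF.
have Pw0 : 0 < 1 - Phi w by rewrite lt_neqAle eq_sym Pw PwC0.
apply: damped_ratio_bound => //.
- apply/andP; split; first by rewrite /c mulr_ge0 ?Phi_ge0 // divr_ge0.
  rewrite /c mulr_ile1 ?Phi_le1 ?Phi_ge0 ?divr_ge0 //.
  by rewrite ler_pdivrMr // mul1r.
- by rewrite divr_ge0 // ltW.
- by rewrite gtr0_norm.
Qed.

(** Mirror image of [stein_l_bound]: for negative [w], [Phi z] is traded for [Phi w]. *)
Lemma stein_r_bound w : z <= w ->
  `|stein_r w| <= mills_bound /\ `|w * stein_r w| <= 1.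
Proof.
move=> zw; have pw := gauss_pdf_gt0 w; rewrite /stein_r.
have [w0|w0] := leP 0 w.
  have [H1 H2] := ratio_r w w0; apply: damped_ratio_bound => //.
    by rewrite divr_ge0 ?(ltW pw) //; case/andP: (PhiC01 w).
  by rewrite ger0_norm.
have [H1 H2] := ratio_l w (ltW w0).
set c := Phi z / Phi w * (1 - Phi w).
have PC : Phi z <= Phi w by rewrite Phi_le.
have PzC0 := Phi_ge0 z.
have PwC0 := Phi_ge0 w.
have [Pw|Pw] := eqVneq (Phi w) 0.
  have -> : Phi z = 0 by apply/eqP; rewrite eq_le PzC0 -Pw PC.
  by rewrite !(mul0r, mulr0) normr0 ler01 mills_bound_ge0.
have -> : Phi z * ((1 - Phi w) / gauss_pdf w) = c * (Phi w / gauss_pdf w).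
  by rewrite /c; field; rewrite Pw gt_eqF.
have Pw0 : 0 < Phi w by rewrite lt_neqAle eq_sym Pw PwC0.
have /andP[PcC0 PcC1] := PhiC01 w.
apply: damped_ratio_bound => //.
- apply/andP; split; first by rewrite /c mulr_ge0 // divr_ge0.
  rewrite /c mulr_ile1 ?divr_ge0 //.
  by rewrite ler_pdivrMr // mul1r.
- by rewrite divr_ge0 // ltW.
- by rewrite ltr0_norm.
Qed.

End SteinSolution.

(** * Normal approximation at lattice thresholds *)

Section NormalApproximation.
Context {R : realType} (p : nat -> R).
Hypothesis p01 : forall i, 0 <= p i <= 1.

Definition stein_bound : R := 4 * mills_bound + 30.

Lemma pb_normal_approx n m (c s : R) : 0 < s -> 2 <= s ^+ 2 ->
  `|pb_mean p n - c| <= 1 -> `|pb_var p n - s ^+ 2| <= 1 ->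
  `|pbE p n (fun k => (k < m)%:R) - Phi ((m%:R - c) / s)| <= stein_bound / s.
Proof.
move=> s0 s2 mc vs.
pose w k : R := (k%:R - c) / s.
pose z := w m.
(* As [z] is the lattice point [w m], every interval from [w k] to [w k.+1] lies on one side of [z],
   where a single smooth branch applies. *)
pose g k := if (k < m)%N then stein_l z (w k) else stein_r z (w k).
have si : 0 < s^-1 by rewrite invr_gt0.
have w_le i j : (i <= j)%N -> w i <= w j.
  by move=> ij; rewrite /w ler_pM2r // lerD2r ler_nat.
have wS k : w k.+1 - w k = s^-1 by rewrite /w -natr1; field; rewrite gt_eqF.
have wlt k : w k < w k.+1 by rewrite -subr_gt0 wS.
have lr : stein_l z z = stein_r z z by rewrite /stein_l /stein_r; ring.
have gb k : `|g k| <= mills_bound /\ `|w k * g k| <= 1.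
  rewrite /g; case: ltnP => km.
    by apply: stein_l_bound; apply: w_le; exact: ltnW.
  by apply: stein_r_bound; exact: w_le.
have inc k :
  `|g k.+1 - g k - s^-1 * (w k * g k + ((k < m)%:R - Phi z))|
     <= s^-1 ^+ 2 * (mills_bound + 2 * `|w k|) /\
  `|w k.+1 * g k.+1 - w k * g k| <= s^-1 * (mills_bound + 2 * `|w k|).
  have /andP[PC0 PC1] : 0 <= Phi z <= 1 by rewrite Phi_ge0 Phi_le1.
  have [km|mk] := ltnP k m.
    have gk1 : g k.+1 = stein_l z (w k.+1).
      (* At the junction [g] takes the right branch, but the two branches agree at [z]. *)
      rewrite /g; case: ltnP => // mk; have -> : k.+1 = m.
        by apply/eqP; rewrite eqn_leq km mk.
      by rewrite -/z lr.
    have gk : g k = stein_l z (w k) by rewrite /g km.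
    have := stein_increments (stein_l z) (1 - Phi z) mills_bound (w k) (w k.+1).
    have -> : w k * g k + (true%:R - Phi z) = 1 - Phi z + w k * g k by rewrite addrC.
    rewrite gk gk1 wS; apply => //.
    - by rewrite ler_norml; apply/andP; split; lra.
    - exact: is_derive_stein_l.
    - move=> x /andP[_ x1]; apply: (proj1 (stein_l_bound _ _ _)).
      by apply: (le_trans x1); exact: w_le.
    - move=> x /andP[_ x1]; apply: (proj2 (stein_l_bound _ _ _)).
      by apply: (le_trans x1); exact: w_le.
  have gk : g k = stein_r z (w k) by rewrite /g ltnNge mk.
  have gk1 : g k.+1 = stein_r z (w k.+1) by rewrite /g ltnNge (leqW mk).
  have := stein_increments (stein_r z) (- Phi z) mills_bound (w k) (w k.+1).
  have -> : w k * g k + (false%:R - Phi z) = - Phi z + w k * g k by rewrite addrC sub0r.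
  rewrite gk gk1 wS; apply => //.
  - by rewrite normrN ler_norml; apply/andP; split; lra.
  - exact: is_derive_stein_r.
  - move=> x /andP[x0 _]; apply: (proj1 (stein_r_bound _ _ _)).
    by apply: le_trans x0; exact: w_le.
  - move=> x /andP[x0 _]; apply: (proj2 (stein_r_bound _ _ _)).
    by apply: le_trans x0; exact: w_le.
apply: (@discrete_stein_bound R p p01 n m g c s mills_bound _) => // k.
- by case: (gb k).
- by case: (gb k).
- have [_ H] := inc k; apply: le_trans H _.
  rewrite mulrC ler_pM2r //; lra.
- have [H _] := inc k.
  have -> : s * (g k.+1 - g k) - (w k * g k + ((k < m)%:R - Phi z)) =
    s * (g k.+1 - g k - s^-1 * (w k * g k + ((k < m)%:R - Phi z))).
    by field; rewrite gt_eqF.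
  rewrite normrM gtr0_norm // mulrC -ler_pdivlMr //; apply: le_trans H _.
  rewrite expr2 -mulrA mulrC ler_pM2r // mulrC ler_pM2r //; lra.
Qed.

End NormalApproximation.

(** * Comparison of the exact mean and variance with [mu_T] and [sigma2_T] *)

Section MeanVarianceApproximation.
Context {R : realType} (t : R).
Hypothesis t0 : 0 < t.

Definition ewens_p (i : nat) : R := t / (t + i%:R).

Let tn0 n : 0 < t + n%:R. Proof. by rewrite ltr_wpDr. Qed.

Lemma ewens_p01 i : 0 <= ewens_p i <= 1.
Proof.
rewrite /ewens_p divr_ge0 ?(ltW t0) ?(ltW (tn0 i)) //=.
by rewrite ler_pdivrMr // mul1r lerDl.
Qed.

Lemma ln_le_sub1 (y : R) : 0 < y -> ln y <= y - 1.
Proof. by move=> y0; rewrite -{1}(subrKC 1 y); apply: le_ln1Dx; lra. Qed.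

Lemma ln_ge_1subV (y : R) : 0 < y -> 1 - y^-1 <= ln y.
Proof.
move=> y0; have := @ln_le_sub1 y^-1; rewrite invr_gt0 lnV ?posrE // => /(_ y0).
lra.
Qed.

Let mu_TS n : mu_T n.+1 t = mu_T n t + t * ln ((t + n.+1%:R) / (t + n%:R)).
Proof.
have tn := tn0 n; have tn1 := tn0 n.+1.
rewrite /mu_T -mulrDr; congr (_ * _).
have E k : 1 + k%:R / t = (t + k%:R) / t by field; rewrite gt_eqF.
rewrite !E -lnM ?posrE ?divr_gt0 //; congr ln.
by field; rewrite !gt_eqF.
Qed.

(** [mu_T] is the integral of [t / (t + x)] from 0 to [n], so each increment lies between
    [ewens_p n.+1] and [ewens_p n]. Subtracting [ewens_p n] in the upper bound makes the induction
    telescope. *)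
Lemma pb_mean_mu_T n :
  mu_T n t <= pb_mean ewens_p n <= mu_T n t + 1 - ewens_p n.
Proof.
elim: n => [|n /andP[IH1 IH2]].
  rewrite /mu_T /pb_mean big_ord0 mul0r addr0 ln1 mulr0 lexx add0r /ewens_p.
  by rewrite addr0 divff ?gt_eqF // subrr lexx.
have tn := tn0 n; have tn1 := tn0 n.+1.
rewrite pb_meanS mu_TS.
set y := (t + n.+1%:R) / (t + n%:R).
have y0 : 0 < y by rewrite divr_gt0.
have H1 : t * ln y <= ewens_p n.
  have -> : ewens_p n = t * (y - 1).
    by rewrite /ewens_p /y -natr1; field; rewrite gt_eqF.
  by rewrite ler_pM2l // ln_le_sub1.
have H2 : ewens_p n.+1 <= t * ln y.
  have -> : ewens_p n.+1 = t * (1 - y^-1).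
    rewrite /ewens_p /y invf_div; move: tn1; rewrite -natr1 => tn1.
    by field; rewrite gt_eqF.
  by rewrite ler_pM2l // ln_ge_1subV.
by apply/andP; split; lra.
Qed.

(** [L] is the integral of the squared summand; its increment is exactly [ewens_p n * ewens_p n.+1],
    which lies between consecutive squares. *)
Let sum_sqr n : let L := t - t ^+ 2 / (t + n%:R) in
  L <= \sum_(i < n) ewens_p i ^+ 2 <= L + 1 - ewens_p n ^+ 2.
Proof.
elim: n => [|n /andP[IH1 IH2]] /=.
  rewrite big_ord0 addr0 /ewens_p addr0 divff ?gt_eqF //.
  have -> : t - t ^+ 2 / t = 0 by field; rewrite gt_eqF.
  by rewrite expr1n add0r subrr lexx.
have tn := tn0 n; have tn1 := tn0 n.+1.
have E : t - t ^+ 2 / (t + n.+1%:R) =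
    t - t ^+ 2 / (t + n%:R) + ewens_p n * ewens_p n.+1.
  rewrite /ewens_p; move: tn1; rewrite -natr1 => tn1.
  by field; rewrite !gt_eqF.
have /andP[p0 _] := ewens_p01 n; have /andP[q0 _] := ewens_p01 n.+1.
have pq : ewens_p n.+1 <= ewens_p n.
  by rewrite ler_pM2l // lef_pV2 // lerD2l ler_nat.
have H1 : ewens_p n * ewens_p n.+1 <= ewens_p n ^+ 2.
  by rewrite expr2 ler_wpM2l.
have H2 : ewens_p n.+1 ^+ 2 <= ewens_p n * ewens_p n.+1.
  by rewrite expr2 ler_wpM2r.
by rewrite E big_ord_recr /=; apply/andP; split; lra.
Qed.

Lemma pb_mean_close n : `|pb_mean ewens_p n - mu_T n t| <= 1.
Proof.
have /andP[H1 H2] := pb_mean_mu_T n; have /andP[p0 _] := ewens_p01 n.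
by rewrite ler_norml; apply/andP; split; lra.
Qed.

Lemma pb_var_close n : `|pb_var ewens_p n - sigma2_T n t| <= 1.
Proof.
have /andP[H1 H2] := pb_mean_mu_T n; have /andP[p0 _] := ewens_p01 n.
have /andP[H3 H4] := sum_sqr n; have p2 := sqr_ge0 (ewens_p n).
have -> : pb_var ewens_p n = pb_mean ewens_p n - \sum_(i < n) ewens_p i ^+ 2.
  rewrite /pb_var /pb_mean -sumrB; apply: eq_bigr => i _; ring.
have -> : sigma2_T n t = mu_T n t - (t - t ^+ 2 / (t + n%:R)).
  rewrite /sigma2_T /mu_T (addrC n%:R); field.
  by rewrite gt_eqF.
by rewrite ler_norml; apply/andP; split; lra.
Qed.

(* Apply [1 - 1 / y <= ln y] at [y = sqrt (1 + n / t)]. *)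
Lemma sigma2_T_ge_sqr n (x := n%:R / t) :
  t * (x / ((1 + x) * (2 + x))) ^+ 2 <= sigma2_T n t.
Proof.
have x0 : 0 <= x by rewrite divr_ge0 // ltW.
rewrite /sigma2_T ler_pM2l // -/x.
have -> : t / (n%:R + t) = (1 + x)^-1.
  have -> : 1 + x = (n%:R + t) / t by rewrite /x; field; rewrite gt_eqF.
  by rewrite invf_div.
pose y := Num.sqrt (1 + x).
have y2 : y ^+ 2 = 1 + x by rewrite sqr_sqrtr //; lra.
have y1 : 1 <= y.
  by rewrite -(ler_pXn2r (isT : (0 < 2)%N)) ?nnegrE ?sqrtr_ge0 // y2 expr1n; lra.
have y0 : 0 < y by lra.
have yx : y <= 1 + x by rewrite -y2 expr2 ler_peMl // ltW.
rewrite -y2 lnXn // .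
have L := ln_ge_1subV _ y0.
have -> : y ^- 2 = y^-1 ^+ 2 by rewrite exprVn.
(* Factor [x = (y - 1) * (y + 1)] and use [y + 1 <= 2 + x <= y * (2 + x)]. *)
have S : (x / (y ^+ 2 * (2 + x))) <= 1 - y^-1.
  have -> : x / (y ^+ 2 * (2 + x)) = ((y - 1) * (y + 1)) / (y ^+ 2 * (2 + x)).
    by congr (_ / _); have := y2; lra.
  have -> : 1 - y^-1 = (y - 1) / y by field; rewrite gt_eqF.
  rewrite -mulrA ler_wpM2l ?subr_ge0 // ler_pdivrMr ?mulr_gt0 ?exprn_gt0 //; last by lra.
  have -> : y^-1 * (y ^+ 2 * (2 + x)) = y * (2 + x) by field; rewrite gt_eqF.
  have : (2 + x) <= y * (2 + x) by rewrite ler_peMl //; lra.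
  lra.
have S0 : 0 <= x / (y ^+ 2 * (2 + x)).
  by rewrite divr_ge0 // mulr_ge0 ?sqr_ge0 //; lra.
have : (x / (y ^+ 2 * (2 + x))) ^+ 2 <= (1 - y^-1) ^+ 2.
  by rewrite lerXn2r ?nnegrE //; lra.
(* With [1 - y^-1 <= ln y], the right side is at most [2 * ln y + y^-1 ^+ 2 - 1], which is
   [sigma2_T n t] divided by [t]. *)
have -> : (1 - y^-1) ^+ 2 = 2 * (1 - y^-1) + y^-1 ^+ 2 - 1 by ring.
rewrite -[ln y *+ 2]mulr_natl; lra.
Qed.

Lemma sigma2_T_ge_ln n (x := n%:R / t) : 0 < x ->
  t * (ln x - 1) <= sigma2_T n t.
Proof.
move=> x0; rewrite /sigma2_T ler_pM2l // -/x.
have : ln x <= ln (1 + x) by rewrite ler_ln ?posrE //; lra.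
have : 0 <= t / (n%:R + t) by rewrite divr_ge0 ?addr_ge0 // ltW.
lra.
Qed.

End MeanVarianceApproximation.

(** * Identification of the law of [K] with the Bernoulli sum *)

Section EwensLaw.
Context {R : realType}.

Lemma rising_factorialS (A : nzSemiRingType) (a : A) n :
  rising_factorial a n.+1 = rising_factorial a n * (a + n%:R).
Proof. by rewrite /rising_factorial big_ord_recr. Qed.

Lemma sbarS0 n : sbar R n.+1 0 = n%:R * sbar R n 0.
Proof.
rewrite /sbar rising_factorialS mulrDr coefD coefMX /= add0r.
by rewrite -polyC_natr coefMC mulrC.
Qed.

Lemma sbarSS n x : sbar R n.+1 x.+1 = sbar R n x + n%:R * sbar R n x.+1.
Proof.
rewrite /sbar rising_factorialS mulrDr coefD coefMX /=.
by rewrite -polyC_natr coefMC [_%:R * _]mulrC.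
Qed.

Lemma sbar_gt n x : (n < x)%N -> sbar R n x = 0.
Proof.
elim: n x => [|n IH] [|x] // nx.
  by rewrite /sbar /rising_factorial big_ord0 coef1.
by rewrite sbarSS !IH ?mulr0 ?addr0 // ltnW.
Qed.

Lemma sbar0 n : (0 < n)%N -> sbar R n 0 = 0.
Proof.
by case: n => // n _; elim: n => [|n IH]; rewrite sbarS0 ?mul0r ?IH ?mulr0.
Qed.

Variable t : R.
Hypothesis t0 : 0 < t.

Lemma rising_factorial_gt0 n : 0 < rising_factorial t n.
Proof. by apply: prodr_gt0 => i _; rewrite ltr_wpDr. Qed.

(** The new factor [t + n%:R] splits into [t] for a success and [n%:R] for a failure, which matches
    the recurrence [sbarSS]. *)
Lemma pbE_sbar n (g : nat -> R) :
  rising_factorial t n * pbE (ewens_p t) n g =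
  \sum_(x < n.+1) sbar R n x * t ^+ x * g x.
Proof.
elim: n g => [|n IH] g.
  rewrite big_ord1 /= /sbar /rising_factorial !big_ord0 coef1 /=.
  by rewrite expr0 !mul1r.
have tn : 0 < t + n%:R by rewrite ltr_wpDr.
rewrite rising_factorialS /=.
have -> : rising_factorial t n * (t + n%:R) *
    (ewens_p t n * pbE (ewens_p t) n (fun k => g k.+1) +
     (1 - ewens_p t n) * pbE (ewens_p t) n g) =
  t * (rising_factorial t n * pbE (ewens_p t) n (fun k => g k.+1)) +
  n%:R * (rising_factorial t n * pbE (ewens_p t) n g).
  by rewrite /ewens_p; field; rewrite gt_eqF.
rewrite !IH [RHS]big_ord_recl /= sbarS0.
have -> : n%:R * \sum_(x < n.+1) sbar R n x * t ^+ x * g x =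
   n%:R * \sum_(x < n.+2) sbar R n x * t ^+ x * g x.
  by rewrite [in RHS]big_ord_recr /= sbar_gt // !mul0r addr0.
rewrite [in LHS](big_ord_recl n.+1) /= mulrDr addrCA; congr (_ + _).
  by ring.
rewrite !mulr_sumr -big_split /=; apply: eq_bigr => i _.
by rewrite /bump /= add1n sbarSS exprS; ring.
Qed.

Context {d : measure_display} {T : measurableType d} {P : probability T R}.
Variables (n : nat) (K : {RV P >-> R}).
Hypotheses (n0 : (0 < n)%N) (K_law : has_law_K n t K).

Let mass k : R := sbar R n k * t ^+ k / rising_factorial t n.

(** The index 0 is excluded because [has_law_K] prescribes masses from 1 on; its weight vanishes by
    [sbar0]. *)
Let pbE_mass (b : pred nat) :
  \sum_(i < n.+1 | b i && (0 < i)%N) mass i = pbE (ewens_p t) n (fun k => (b k)%:R).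
Proof.
have r0 := rising_factorial_gt0 n.
apply: (mulfI (lt0r_neq0 r0)); rewrite pbE_sbar mulr_sumr big_mkcond /=.
apply: eq_bigr => -[[|i] ilt] _ /=.
  by rewrite andbF sbar0 // !mul0r.
rewrite andbT; case: (b _); last by rewrite mulr0.
by rewrite /mass mulr1; field; rewrite gt_eqF.
Qed.

Let atom_measurable (a : R) : measurable [set w | K w = a].
Proof. by apply: (measurable_funPTI K (Y := [set a])); exact: measurable_set1. Qed.

(** [A] contains the disjoint atoms selected by [b]. Only an inequality is claimed, since [K] may
    take other values on a null set. *)
Let mass_le (b : pred nat) (A : set T) : measurable A ->
  (forall w k, K w = k%:R -> b k -> A w) ->
  ((pbE (ewens_p t) n (fun k => (b k)%:R))%:E <= P A)%E.
Proof.
move=> mA bA; rewrite -pbE_mass -sumEFin.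
pose F (i : 'I_n.+1) := [set w | K w = i%:R].
have mF i : measurable (F i) by exact: atom_measurable.
rewrite (eq_bigr (fun i => P (F i))); last first.
  move=> i /andP[_ i0]; rewrite /F K_law //.
  by rewrite i0 /= -ltnS.
rewrite -(measure_bigsetU_ord P _ mF); last first.
  apply/trivIsetP => i j _ _ ij; rewrite -subset0 => w [].
  by rewrite /F /= => -> /eqP; rewrite eqr_nat => /eqP /val_inj E; rewrite E eqxx in ij.
apply: le_measure; rewrite ?inE //; first exact: bigsetU_measurable.
apply: (big_ind (fun S => S `<=` A)) => //; first by move=> S S'; rewrite subUset.
by move=> i /andP[bi _] w /= Kw; exact: bA Kw bi.
Qed.

(** [mass_le] for the event and for its complement gives the two inequalities, as the total mass is
    1. *)
Lemma cdf_pbE (y : R) :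
  P [set w | K w <= y] = (pbE (ewens_p t) n (fun k => (k%:R <= y)%R%:R))%:E.
Proof.
have mA : measurable [set w | K w <= y].
  have -> : [set w | K w <= y] = K @^-1` `]-oo, y].
    by apply/seteqP; split => w /=; rewrite in_itv.
  exact: (measurable_funPTI K (Y := `]-oo, y])).
apply/eqP; rewrite eq_le; apply/andP; split; last first.
  by apply: mass_le => // w k /= ->.
have := @mass_le (fun k => ~~ (k%:R <= y)) (~` [set w | K w <= y]).
rewrite probability_setC //.
have -> : pbE (ewens_p t) n (fun k => (~~ (k%:R <= y)%R)%:R) =
   1 - pbE (ewens_p t) n (fun k => (k%:R <= y)%R%:R).
  rewrite (@pbE_comb _ _ n 1 (-1) (fun=> 1) (fun k => (k%:R <= y)%R%:R)).
    by rewrite pbE_cst; ring.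
  by move=> k; case: (_ <= y); rewrite /=; ring.
move=> H.
have {H} : ((1 - pbE (ewens_p t) n (fun k => (k%:R <= y)%R%:R))%:E <=
    1 - P [set w | (K w <= y)%R])%E.
  by apply: H; [exact: measurableC | move=> w k /= -> /negP].
have Pf : P [set w | K w <= y] \is a fin_num by rewrite fin_num_measure.
rewrite -(fineK Pf) -EFinB !lee_fin; lra.
Qed.

End EwensLaw.

(** * Uniform bound at arbitrary real thresholds *)

Section BerryEsseen.
Context {R : realType} (t : R) (n : nat).
Context {d : measure_display} {T : measurableType d} {P : probability T R}.
Variable K : {RV P >-> R}.
Hypotheses (t0 : 0 < t) (n0 : (0 < n)%N) (K_law : has_law_K n t K).
Hypothesis s2_ge2 : 2 <= sigma2_T n t.

Definition berry_esseen_bound : R := stein_bound + normal_peak 1.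

Let s := sigma_T n t.

Let s2E : s ^+ 2 = sigma2_T n t.
Proof. by rewrite /s /sigma_T sqr_sqrtr //; apply: le_trans s2_ge2. Qed.

Let s0 : 0 < s.
Proof. by rewrite /s /sigma_T sqrtr_gt0; apply: lt_le_trans s2_ge2. Qed.

Let peak0 : 0 <= normal_peak 1 :> R. Proof. exact: normal_peak_ge0. Qed.

Let G_T_pbE (x : R) : G_T n t K x =
  pbE (ewens_p t) n (fun k => (k%:R <= mu_T n t + s * x)%R%:R).
Proof.
rewrite /G_T /cdf /distribution /pushforward.
rewrite -[RHS]/(fine (_%:E)) -(cdf_pbE t t0 n K n0 K_law); congr (fine (P _)).
apply/seteqP; split => w /=; rewrite in_itv /= /Y_T ler_pdivrMr // lerBlDl mulrC //.
Qed.

Lemma berry_esseen (x : R) : `|G_T n t K x - Phi x| <= berry_esseen_bound / s.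
Proof.
rewrite G_T_pbE; set y := mu_T n t + s * x.
(* Chosen so that [k%:R <= y] is equivalent to [k < m]; negative [y] is set apart because truncation
   would send it to 0 and yield [m = 1]. *)
pose m := if 0 <= y then (Num.truncn y).+1 else 0%N.
have approx : `|pbE (ewens_p t) n (fun k => (k < m)%:R)
      - Phi ((m%:R - mu_T n t) / s)| <= stein_bound / s.
  apply: pb_normal_approx => //.
  - exact: ewens_p01.
  - by rewrite s2E.
  - exact: pb_mean_close.
  - by rewrite s2E; exact: pb_var_close.
have -> : pbE (ewens_p t) n (fun k => (k%:R <= y)%R%:R) =
    pbE (ewens_p t) n (fun k => (k < m)%:R).
  apply: eq_pbE => k; rewrite /m; case: (leP 0 y) => y0.
    by rewrite ltnS truncn_ge_nat.
  by rewrite ltn0 leNgt (lt_le_trans y0).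
set z := (m%:R - mu_T n t) / s in approx.
have xE : x = (y - mu_T n t) / s by rewrite /y; field; rewrite gt_eqF.
have ym : y <= m%:R.
  rewrite /m; case: (leP 0 y) => [y0|/ltW //].
  by have /andP[_ /ltW] := truncn_itv y0.
have xz : x <= z by rewrite xE /z ler_pM2r ?invr_gt0 // lerD2r.
have Pxz := Phi_le x z xz.
rewrite /berry_esseen_bound mulrDl.
have ps : 0 <= normal_peak 1 / s by rewrite divr_ge0 // ltW.
(* For [0 <= y] rounding moves the threshold by at most [s^-1]. For [y < 0] the gap may be large,
   but the probability is 0 and [Phi x <= Phi z], which [approx] already bounds. *)
have : (Phi z - Phi x <= normal_peak 1 / s) \/
   (pbE (ewens_p t) n (fun k => (k < m)%:R) = 0).
  rewrite /m; case: (leP 0 y) => y0; last by right; rewrite pbE_cst.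
  left; apply: le_trans (Phi_lipschitz x z xz) _; rewrite ler_wpM2l //.
  rewrite xE /z -mulrBl ler_piMl ?invr_ge0 ?(ltW s0) // /m y0.
  have /andP[H _] := truncn_itv y0; rewrite -natr1; lra.
have Px := Phi_ge0 x.
move: approx; rewrite !ler_norml => /andP[? ?] [?|E0]; apply/andP; split; lra.
Qed.

Lemma sup_norm_berry_esseen :
  `|sup_norm (fun x => G_T n t K x - Phi x)| <= berry_esseen_bound / s.
Proof.
rewrite /sup_norm; set S := (X in sup X).
have S0 : S (`|G_T n t K 0 - Phi 0|) by exists 0.
have ubS : ubound S (berry_esseen_bound / s).
  by move=> _ [x _ <-]; exact: berry_esseen.
rewrite ger0_norm; first by apply: ge_sup => //; exists (`|G_T n t K 0 - Phi 0|).
apply: (le_trans (normr_ge0 (G_T n t K 0 - Phi 0))).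
by apply: ub_le_sup => //; exists (berry_esseen_bound / s).
Qed.

End BerryEsseen.

(** * From lower bounds on the variance to rates *)

Section Rates.
Context {R : realType} (theta : nat -> R).
Hypothesis theta_gt0 : forall n : nat, (1 <= n)%N -> 0 < theta n.
Context (d : nat -> measure_display) (T : forall n : nat, measurableType (d n))
  (P : forall n : nat, probability (T n) R)
  (K : forall n : nat, {RV (P n) >-> R}).
Hypothesis K_law : forall n : nat, (1 <= n)%N -> has_law_K n (theta n) (K n).

Lemma sup_norm_bigO (v : nat -> R) (c : R) : 0 < c ->
  v n @[n --> \oo] --> +oo ->
  (\forall n \near \oo, c * v n <= sigma2_T n (theta n)) ->
  (fun n : nat => sup_norm (fun x : R => G_T n (theta n) (K n) x - Phi x))
    =O_\oo (fun n : nat => (Num.sqrt (v n))^-1).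
Proof.
move=> c0 /cvgryPge vy cv; have sc : 0 < Num.sqrt c by rewrite sqrtr_gt0.
have B0 : 0 < berry_esseen_bound :> R.
  have := @mills_bound_ge0 R; have := @normal_peak_ge0 R 1.
  by rewrite /berry_esseen_bound /stein_bound; lra.
apply/eqO_exP; exists (berry_esseen_bound / Num.sqrt c); first by rewrite divr_gt0.
near=> n.
have n0 : (0 < n)%N by near: n; exact: nbhs_infty_gt.
(* This threshold ensures [2 <= sigma2_T n (theta n)], as the uniform bound requires. *)
have vc : 2 / c <= v n by near: n; exact: vy.
have v0 : 0 < v n by apply: lt_le_trans vc; rewrite divr_gt0.
have cvn : c * v n <= sigma2_T n (theta n) by near: n.
have s2 : 2 <= sigma2_T n (theta n).
  by apply: le_trans cvn; rewrite mulrC -ler_pdivrMr.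
apply: le_trans (sup_norm_berry_esseen _ _ (K n) (theta_gt0 _ n0) n0 (K_law _ n0) s2) _.
rewrite ger0_norm ?invr_ge0 // -mulrA -invfM -sqrtrM ?(ltW c0) //.
have s2_gt0 : 0 < sigma2_T n (theta n) by exact: lt_le_trans s2.
rewrite ler_pM2l // lef_pV2 ?posrE /sigma_T ?sqrtr_gt0 //; last exact: mulr_gt0.
by rewrite ler_sqrt // ltW.
Unshelve. all: by end_near. Qed.

End Rates.

Theorem corollary2p3 (R : realType) (theta : nat -> R)
  (theta_gt0 : forall n : nat, (1 <= n)%N -> 0 < theta n)
  (theta_nd : forall m n : nat, (1 <= m)%N -> (m <= n)%N -> theta m <= theta n)
  (d : nat -> measure_display) (T : forall n : nat, measurableType (d n))
  (P : forall n : nat, probability (T n) R)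
  (K : forall n : nat, {RV (P n) >-> R})
  (K_law : forall n : nat, (1 <= n)%N -> has_law_K n (theta n) (K n)) :
  [/\ case_A theta ->
        (fun n : nat => sup_norm (fun x : R => G_T n (theta n) (K n) x - Phi x))
        =O_\oo (fun n : nat => (Num.sqrt (theta n * ln (n%:R / theta n)))^-1),
      case_B theta ->
        (fun n : nat => sup_norm (fun x : R => G_T n (theta n) (K n) x - Phi x))
        =O_\oo (fun n : nat => (Num.sqrt (theta n))^-1)
    & case_C1 theta ->
        (fun n : nat => sup_norm (fun x : R => G_T n (theta n) (K n) x - Phi x))
        =O_\oo (fun n : nat => (Num.sqrt (n%:R ^+ 2 / theta n))^-1)].
Proof.
have th1 n : (1 <= n)%N -> theta 1%N <= theta n by exact: theta_nd.
have t1 : 0 < theta 1%N by exact: theta_gt0.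
have x_gt0 n : (1 <= n)%N -> 0 < n%:R / theta n.
  by move=> n1; rewrite divr_gt0 ?ltr0n ?theta_gt0.
split=> [/cvgryPge xA | [c c0 xc] | [x0 vy]].
- have lnA B : \forall n \near \oo, B <= ln (n%:R / theta n).
    near=> n.
    have n1 : (1 <= n)%N by near: n; exact: nbhs_infty_ge.
    rewrite -ler_expR lnK ?posrE ?x_gt0 //.
    by near: n; exact: xA.
  (* Once the logarithm is at least 2, subtracting 1 leaves at least half of it. *)
  apply: (@sup_norm_bigO R theta theta_gt0 d T P K K_law _ 2^-1) => //.
    apply/cvgryPge => B; near=> n.
    have n1 : (1 <= n)%N by near: n; exact: nbhs_infty_ge.
    have l0 : 0 <= ln (n%:R / theta n) by near: n; exact: lnA.
    (* Monotonicity keeps [theta n] above [theta 1], so the product diverges with the logarithm. *)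
    apply: le_trans (ler_wpM2r l0 (th1 _ n1)).
    by rewrite mulrC -ler_pdivrMr //; near: n; exact: lnA.
  near=> n.
  have n1 : (1 <= n)%N by near: n; exact: nbhs_infty_ge.
  have l2 : 2 <= ln (n%:R / theta n) by near: n; exact: lnA.
  apply: le_trans (sigma2_T_ge_ln _ (theta_gt0 _ n1) n (x_gt0 _ n1)).
  rewrite mulrCA ler_pM2l ?theta_gt0 //; lra.
(* Eventually the ratio [x] lies between [c / 2] and [2 * c]; [b] takes the numerator of
   [x / ((1 + x) * (2 + x))] at the lower end and the denominator at the upper end. *)
- pose b := (c / 2) / ((1 + 2 * c) * (2 + 2 * c)).
  have b0 : 0 < b by rewrite divr_gt0 ?mulr_gt0 //; lra.
  have xlo : \forall n \near \oo, c / 2 <= n%:R / theta n.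
    by apply: (cvgr_ge _ xc); lra.
  have xhi : \forall n \near \oo, n%:R / theta n <= 2 * c.
    by apply: (cvgr_le _ xc); lra.
  apply: (@sup_norm_bigO R theta theta_gt0 d T P K K_law _ (b ^+ 2)).
  + by rewrite exprn_gt0.
  (* [theta n] diverges because it is at least [n%:R / (2 * c)]. *)
  + apply/cvgryPge => B; near=> n.
    have n1 : (1 <= n)%N by near: n; exact: nbhs_infty_ge.
    have h : n%:R / theta n <= 2 * c by near: n.
    have hB : B * (2 * c) <= n%:R.
      near: n; exact: nbhs_infty_ger.
    move: h; rewrite ler_pdivrMr ?theta_gt0 // mulrC => h.
    by rewrite -(ler_pM2r (_ : 0 < 2 * c)) ?mulr_gt0 //; apply: le_trans h.
  near=> n.
  have n1 : (1 <= n)%N by near: n; exact: nbhs_infty_ge.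
  have h : n%:R / theta n <= 2 * c by near: n.
  have l : c / 2 <= n%:R / theta n by near: n.
  have xn := x_gt0 _ n1.
  apply: le_trans (sigma2_T_ge_sqr _ (theta_gt0 _ n1) n).
  rewrite mulrC ler_pM2l ?theta_gt0 //.
  set x := n%:R / theta n in h l xn *.
  rewrite lerXn2r // ?nnegrE ?(ltW b0) //.
    by apply: divr_ge0; [exact: ltW | apply: mulr_ge0; lra].
  rewrite /b.
  apply: ler_pM => //; [lra | by rewrite invr_ge0 mulr_ge0 //; lra |].
  rewrite lef_pV2 ?posrE ?mulr_gt0 //; try lra.
  by apply: ler_pM; lra.
(* For [x <= 1] the denominator [(1 + x) * (2 + x)] is at most 6. *)
apply: (@sup_norm_bigO R theta theta_gt0 d T P K K_law _ (6^-1 ^+ 2)) => //.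
have xhi : \forall n \near \oo, n%:R / theta n <= 1.
  by apply: (cvgr_le _ x0); lra.
near=> n.
have n1 : (1 <= n)%N by near: n; exact: nbhs_infty_ge.
have h : n%:R / theta n <= 1 by near: n.
have xn := x_gt0 _ n1; have tn := theta_gt0 _ n1.
apply: le_trans (sigma2_T_ge_sqr _ tn n).
have -> : 6^-1 ^+ 2 * (n%:R ^+ 2 / theta n) =
    theta n * (n%:R / theta n * 6^-1) ^+ 2 by field; rewrite gt_eqF.
set x := n%:R / theta n in h xn *.
rewrite ler_pM2l // lerXn2r // ?nnegrE; first by apply: mulr_ge0; lra.
  by apply: divr_ge0; [exact: ltW | apply: mulr_ge0; lra].
rewrite ler_pM2l // lef_pV2 ?posrE ?mulr_gt0 //; try lra.
have -> : 6 = 2 * 3 :> R by ring.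
by apply: ler_pM; lra.
Unshelve. all: by end_near. Qed.
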